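(* Any read-once branching program computing MedianBit for $n$ integers from $[2n]$ requires size $2^{n^{\Omega(1)}}$.
   Context: $[N]=\{1,\dots,N\}$. For $n$ input integers, the median is the middle element in sorted order (the $n/2$-th largest when $n$ is even), and MedianBit is the low order bit of the median. A branching program on $n$ inputs from a finite set $D$ (here $D=[2n]$) is a connected directed acyclic multigraph with a source node and possibly many sink nodes; each non-sink node is labeled by an input index in $[n]$ and has exactly one out-edge labeled by each element of $D$; each sink is labeled by an output value. On input $x\in D^n$, the computation starts at the source and at each node queries the input at the node's index and follows the edge labeled by its value, until a sink is reached, whose label is the output. Its size is its number of nodes. It is (syntactic) read-once if no input index appears more than once on any path from the source to a sink; the order of the queries may depend on the input. *)

(* Defs.v *)
From mathcomp Require Import all_boot all_order all_algebra.
From mathcomp Require Import reals exp.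
Set Implicit Arguments.
Unset Strict Implicit.
Unset Printing Implicit Defensive.

(* [kind v = inl (i, f)]: [v] is a non-sink node querying input [i], with one
   out-edge, to [f d], for each [d : D]; parallel edges are allowed since [f]
   need not be injective.  [kind v = inr o]: [v] is a sink labeled by [o]. *)
Record labeled_graph (n : nat) (D : finType) (O : Type) := LabeledGraph {
  node : finType;
  source : node;
  kind : node -> ('I_n * {ffun D -> node}) + O
}.

Definition edge (n : nat) (D : finType) (O : Type)
    (G : labeled_graph n D O) : rel (node G) :=
  fun u v => if kind u is inl (_, f) then [exists d, f d == v] else false.

Definition is_sink (n : nat) (D : finType) (O : Type)
    (G : labeled_graph n D O) (v : node G) : bool :=
  if kind v is inr _ then true else false.

Definition query (n : nat) (D : finType) (O : Type)
    (G : labeled_graph n D O) (v : node G) : option 'I_n :=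
  if kind v is inl (i, _) then Some i else None.

(* Connectedness is that of the underlying undirected graph. *)
Record branching_program (n : nat) (D : finType) (O : Type) :=
  BranchingProgram {
    bp_graph :> labeled_graph n D O;
    bp_acyclic : forall p : seq (node bp_graph),
      cycle (@edge n D O bp_graph) p -> p = [::];
    bp_connected : forall u v : node bp_graph,
      connect (fun a b => edge a b || edge b a) u v;
    bp_source : forall u : node bp_graph, ~~ edge u (source bp_graph)
  }.

Definition size_bp (n : nat) (D : finType) (O : Type)
    (B : branching_program n D O) : nat := #|node B|.

(* [run x v o]: on input [x], the computation continued from node [v] reaches a
   sink labeled by [o]. *)
Inductive run (n : nat) (D : finType) (O : Type) (G : labeled_graph n D O)
    (x : {ffun 'I_n -> D}) : node G -> O -> Prop :=
  | run_sink (v : node G) (o : O) : kind v = inr o -> run x v o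
  | run_query (v : node G) (i : 'I_n) (f : {ffun D -> node G}) (o : O) :
      kind v = inl (i, f) -> run x (f (x i)) o -> run x v o.

Definition computes (n : nat) (D : finType) (O : Type)
    (B : branching_program n D O) (F : {ffun 'I_n -> D} -> O) : Prop :=
  forall x : {ffun 'I_n -> D}, run x (source B) (F x).

Definition read_once (n : nat) (D : finType) (O : Type)
    (B : branching_program n D O) : Prop :=
  forall p : seq (node B),
    path (@edge n D O B) (source B) p -> is_sink (last (source B) p) ->
    uniq (pmap (@query n D O B) (source B :: p)).

(* The set {1, ..., N} is represented by ['I_N], the ordinal [j] standing for
   the integer [j.+1]. *)
Definition int_of (N : nat) (j : 'I_N) : nat := j.+1.

(* The [uphalf n]-th largest input, counted with multiplicity: the middle one
   for odd [n], the [n/2]-th largest for even [n].  The default value 0 is only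
   used for [n = 0]. *)
Definition median (n N : nat) (x : {ffun 'I_n -> 'I_N}) : nat :=
  nth 0 (sort geq [seq int_of (x i) | i <- enum 'I_n]) (uphalf n).-1.

Definition median_bit (n N : nat) (x : {ffun 'I_n -> 'I_N}) : bool :=
  odd (median x).

(* Main.v *)
(** A Myhill-Nerode argument, giving the bound [2 ^ (n %/ 4)].  Answer the t-th
    query (t < k = n %/ 4), whatever input it concerns, by one of the two
    consecutive values [2 * t.+1] and [2 * t.+1 + 1].  The resulting 2^k partial
    computations end in distinct nodes.  Indeed, suppose two of them meet in a
    node [v].  By read-onceness, no input queried on either side is queried after
    [v].  If one side queried an input [i] that the other did not, then on the
    other side the output would not depend on [i], although the unqueried inputs
    can be chosen so that [i] is the median.  So both sides queried the same
    inputs; filling the others with extreme values, the median becomes the answer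
    to any prescribed query, in particular to one where the sides differ, yet the
    outputs agree. *)

Require Import Defs.
From mathcomp Require Import all_boot all_order all_algebra.
From mathcomp Require Import reals exp.
From mathcomp Require Import zify.
Import Order.TTheory GRing.Theory Num.Theory.

Set Implicit Arguments.
Unset Strict Implicit.
Unset Printing Implicit Defensive.

Local Open Scope nat_scope.

(** * Query histories and read-once computations *)

Section BranchingPrograms.

Variables (n : nat) (D : finType) (O : Type).

Section Graph.

Variable G : labeled_graph n D O.
Implicit Types (u v w : node G) (q : seq ('I_n * D)) (x : {ffun 'I_n -> D}).

(** The history [q] records queried indices with their answers and mentions no input, so that an
    input agreeing with it can be chosen afterwards. *)
Fixpoint follows u q v : Prop :=
  if q is (i, d) :: q' then
    exists2 f, kind u = inl (i, f) & follows (f d) q' v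
  else u = v.

Definition agrees x q := all (fun a => x a.1 == a.2) q.

Lemma follows_cat u v w q1 q2 :
  follows u q1 v -> follows v q2 w -> follows u (q1 ++ q2) w.
Proof.
elim: q1 u => [|[i d] q IH] u /= => [-> //|[f uE /IH fv] /fv].
by exists f.
Qed.

Lemma follows_path u v q : follows u q v ->
  exists p, [/\ path (@edge n D O G) u p, last u p = v &
                pmap (@query n D O G) (belast u p) = unzip1 q].
Proof.
elim: q u => [|[i d] q IH] u /= => [->|[f uE /IH[p [pp pl pq]]]].
  by exists [::].
exists (f d :: p); split => //=; last by rewrite pq /query uE.
by rewrite pp andbT /edge uE; apply/existsP; exists d.
Qed.

Lemma run_follows_agrees x u v q o :
  follows u q v -> agrees x q -> run x u o -> run x v o.
Proof.
elim: q u => [|[i d] q IH] u /= => [-> //|[f uE fv] /andP[/eqP xi xq] r].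
apply: IH fv xq _; rewrite -xi.
case: r uE => [w o' -> //|w i' f' o' -> r [<- <-]] //.
Qed.

Lemma follows_run x u v q o :
  follows u q v -> agrees x q -> kind v = inr o -> run x u o.
Proof.
elim: q u => [|[i d] q IH] u /= => [-> _|[f uE fv] /andP[/eqP xi xq]] vE.
  exact: run_sink.
by apply: run_query uE _; rewrite xi; apply: IH.
Qed.

Lemma run_follows x u o : run x u o ->
  exists q w, [/\ follows u q w, agrees x q & kind w = inr o].
Proof.
elim=> {u o} [v o vE|v i f o vE _ [q [w [fw xq wE]]]].
  by exists [::], v.
exists ((i, x i) :: q), w; split=> //=; first by exists f.
by rewrite eqxx.
Qed.

Lemma run_sink_inv x v o o' : kind v = inr o -> run x v o' -> o' = o.
Proof. by move=> vE r; case: r vE => [w p -> [->]|w i f p ->]. Qed.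

Lemma run_functional x v o o' : run x v o -> run x v o' -> o = o'.
Proof.
case/run_follows=> q [w [fw xq wE]] r.
by rewrite (run_sink_inv wE (run_follows_agrees fw xq r)).
Qed.

Lemma agrees_map x q : agrees x q = (map x (unzip1 q) == unzip2 q).
Proof. by elim: q => //= -[i d] q IH; rewrite eqseq_cons -IH. Qed.

Lemma eq_agrees x x' q :
  {in unzip1 q, x =1 x'} -> agrees x q -> agrees x' q.
Proof. by rewrite !agrees_map => /eq_in_map ->. Qed.

End Graph.

Variable B : branching_program n D O.
Variable F : {ffun 'I_n -> D} -> O.
Hypothesis ro : read_once B.
Hypothesis BF : computes B F.
Implicit Types (v w : node B) (q : seq ('I_n * D)) (x : {ffun 'I_n -> D}).

Lemma read_once_follows q w : follows (source B) q w -> is_sink w ->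
  uniq (unzip1 q).
Proof.
case/follows_path=> p [pp pl <-] sw; move: (ro pp); rewrite pl => /(_ sw).
rewrite lastI -cats1 pmap_cat pl /=.
move: sw; rewrite /is_sink /query; case: (kind w) => //= _ _.
by rewrite cats0.
Qed.

(** Read-onceness is syntactic, so the rest [q2] of the computation on [x] can be glued to any
    history [q'] reaching [v], even one that [x] does not agree with. *)
Lemma continuation q v x : follows (source B) q v -> agrees x q ->
  exists q2 w, [/\ follows v q2 w, agrees x q2, kind w = inr (F x) &
    forall q', follows (source B) q' v -> uniq (unzip1 q' ++ unzip1 q2)].
Proof.
move=> fv xq; have [q2 [w [fw xq2 wE]]] :=
  run_follows (run_follows_agrees fv xq (BF x)).
exists q2, w; split=> // q' fv'; rewrite -map_cat.
by apply: read_once_follows (follows_cat fv' fw) _; rewrite /is_sink wE.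
Qed.

(** Read-onceness is stated for paths ending in a sink; the computation on [x] extends the history
    to one. *)
Lemma uniq_reach q v x : follows (source B) q v -> agrees x q ->
  uniq (unzip1 q).
Proof.
move=> fv xq; have [q2 [w [_ _ _ /(_ _ fv)]]] := continuation fv xq.
by rewrite cat_uniq => /andP[].
Qed.

(* [q1] is the history of [x'], which may be [q] or [q'] *)
Lemma meet_eq q q' q1 v x x' :
  follows (source B) q v -> follows (source B) q' v ->
  follows (source B) q1 v -> agrees x q -> agrees x' q1 ->
  (forall i, i \notin unzip1 q -> i \notin unzip1 q' -> x i = x' i) ->
  F x = F x'.
Proof.
move=> fv fv' fv1 xq xq1 xx'.
have [q2 [w [fw xq2 wE U]]] := continuation fv xq.
apply: (@run_functional _ x' v); last first.
  exact: run_follows_agrees fv1 xq1 (BF x').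
(* After [v], the computation on [x] reads only indices outside both histories, where [x'] coincides
   with [x]; hence [x'] reaches the same sink. *)
apply: follows_run fw _ wE; apply: eq_agrees xq2 => i iq2.
have notin p : follows (source B) p v -> i \notin unzip1 p.
  move/U; rewrite cat_uniq => /and3P[_ /hasPn/(_ i iq2) ? _]; assumption.
by apply: xx'; apply: notin.
Qed.

Lemma sink_eq q v x x' : follows (source B) q v -> is_sink v ->
  agrees x q -> agrees x' q -> F x = F x'.
Proof.
rewrite /is_sink; case vE: (kind v) => [//|o] fv _ xq xq'.
rewrite (run_sink_inv vE (run_follows_agrees fv xq (BF x))).
by rewrite (run_sink_inv vE (run_follows_agrees fv xq' (BF x'))).
Qed.

(** Fewer than [k] answers in [P] never determine [F], so the node reached is not a sink and asks
    another query. The program chooses the indices, [ds] only the answers. *)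
Lemma reach_answers (P : pred D) k (ds : seq D) :
  (forall q, uniq (unzip1 q) -> all P (unzip2 q) -> size q < k ->
     exists x x', [/\ agrees x q, agrees x' q & F x <> F x']) ->
  all P ds -> size ds <= k ->
  exists q v,
    [/\ follows (source B) q v, uniq (unzip1 q) & unzip2 q = ds].
Proof.
move=> sens; elim/last_ind: ds => [|ds d IH].
  by exists [::], (source B).
rewrite all_rcons size_rcons => /andP[_ Pds] lek.
have [q [v [fv Uq qE]]] := IH Pds (ltnW lek).
have [||x [x' [xq xq' neq]]] := sens _ Uq; rewrite ?qE //.
  by rewrite -(size_map snd) -/(unzip2 q) qE.
have: ~~ is_sink v by apply/negP => sv; apply: neq; apply: sink_eq fv sv _ _.
rewrite /is_sink; case vE: (kind v) => [[i f]|//] _.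
exists (rcons q (i, d)), (f d); split; last by rewrite /unzip2 map_rcons -qE.
- by rewrite -cats1; apply: follows_cat fv _; exists f.
(* [x] need not answer [d] at [i], but distinctness concerns the indices only, so the answer [x i]
   serves as well. *)
have fvd : follows (source B) (rcons q (i, x i)) (f (x i)).
  by rewrite -cats1; apply: follows_cat fv _; exists f.
have xqi : agrees x (rcons q (i, x i)) by rewrite /agrees all_rcons /= eqxx.
by have := uniq_reach fvd xqi; rewrite /unzip1 !map_rcons.
Qed.

End BranchingPrograms.

(** * Order statistics by counting *)

Lemma nth_sort_geq (s : seq nat) p a :
  count (ltn a) s <= p < count (leq a) s -> nth 0 (sort geq s) p = a.
Proof.
have geq_trans : transitive geq.
  by move=> y x z /= xy yz; apply: leq_trans yz xy.
have geq_total : total geq by move=> x y; apply: leq_total.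
have ss := sort_sorted geq_total s.
have pe : perm_eq (sort geq s) s by apply/permPl/perm_sort.
rewrite -!(permP pe); move: (sort geq s) ss => t st /andP[lt_p p_lt].
have pt : p < size t := leq_trans p_lt (count_size _ _).
have mono i j : i <= j -> j < size t -> nth 0 t j <= nth 0 t i.
  move=> ij jt.
  by apply: (sorted_leq_nth geq_trans leqnn 0 st) => //; rewrite inE; lia.
apply/eqP; rewrite eqn_leq; apply/andP; split; rewrite leqNgt; apply/negP=> h.
(* If the entry at [p] exceeded [a], so would the first [p.+1] entries; if it were below [a], so
   would be all entries from [p] on. *)
- suff: p < count (ltn a) t by rewrite ltnNge lt_p.
  rewrite -[t in count _ t](cat_take_drop p.+1) count_cat.
  rewrite (_ : count _ (take _ _) = p.+1) ?leq_addr //.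
  have sz : size (take p.+1 t) = p.+1 by rewrite size_take; case: ltnP; lia.
  rewrite -[RHS]sz; apply/eqP; rewrite -all_count.
  apply/(all_nthP 0) => i; rewrite sz => ip /=; rewrite nth_take //.
  by apply: leq_trans h _; apply: mono.
- suff: count (leq a) t <= p by rewrite leqNgt p_lt.
  rewrite -[t in count _ t](cat_take_drop p) count_cat.
  rewrite [X in _ + X](_ : _ = 0).
    by rewrite addn0 (leq_trans (count_size _ _)) // size_take; case: ltnP; lia.
  apply/eqP; rewrite eqn0Ngt -has_count -all_predC.
  apply/(all_nthP 0) => i; rewrite size_drop => ip /=; rewrite nth_drop -ltnNge.
  by apply: leq_ltn_trans h; apply: mono; lia.
Qed.

Definition unused n (vs : seq 'I_n) : seq 'I_n :=
  [seq i <- enum 'I_n | i \notin vs].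

Lemma perm_unused n (vs : seq 'I_n) : uniq vs ->
  perm_eq (enum 'I_n) (vs ++ unused vs).
Proof.
move=> Uvs; apply: uniq_perm; first exact: enum_uniq.
  rewrite cat_uniq Uvs filter_uniq ?enum_uniq // andbT.
  by apply/hasPn => i; rewrite mem_filter => /andP[].
by move=> i; rewrite mem_enum mem_cat mem_filter mem_enum andbT orbN.
Qed.

Lemma size_unused n (vs : seq 'I_n) : uniq vs ->
  size (unused vs) = n - size vs.
Proof.
move/perm_unused/perm_size; rewrite size_cat size_enum_ord.
by move/esym/(canRL (addKn _)).
Qed.

Lemma fill n (D : finType) (d0 : D) (vs : seq 'I_n) (ds es : seq D) :
  uniq vs -> size ds = size vs -> size es = n - size vs ->
  exists x : {ffun 'I_n -> D}, map x vs = ds /\ map x (unused vs) = es.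
Proof.
move=> Uvs sds ses; pose all_vs := vs ++ unused vs.
have Ua : uniq all_vs by rewrite -(perm_uniq (perm_unused Uvs)) enum_uniq.
have sa : size all_vs = size (ds ++ es).
  by rewrite !size_cat size_unused // sds ses.
exists [ffun i => nth d0 (ds ++ es) (index i all_vs)].
set x := finfun _; have: map x all_vs = ds ++ es.
  apply: (@eq_from_nth _ d0); rewrite size_map // => i ia.
  have i0 : 'I_n by case: (all_vs) ia => [//|j _ _]; exact: j.
  by rewrite (nth_map i0) // ffunE index_uniq.
rewrite map_cat => /eqP; rewrite eqseq_cat ?size_map //.
by case/andP=> /eqP -> /eqP ->.
Qed.

(** The counts compare ordinals instead of the integers they stand for; the shift by one survives
    only in [d.+1]. *)
Lemma median_count n N (x : {ffun 'I_n -> 'I_N}) vs (d : nat) : uniq vs ->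
  count (fun e : 'I_N => d < e) (map x vs) +
    count (fun e : 'I_N => d < e) (map x (unused vs)) <= (uphalf n).-1 <
  count (fun e : 'I_N => d <= e) (map x vs) +
    count (fun e : 'I_N => d <= e) (map x (unused vs)) ->
  median x = d.+1.
Proof.
move=> Uvs h; apply: nth_sort_geq.
have pe := perm_map (fun i => int_of (x i)) (perm_unused Uvs).
by rewrite !(permP pe) map_cat !count_cat !(map_comp _ x)
  ![count _ (map (@int_of N) _)]count_map.
Qed.

(** * Inputs with a prescribed median *)

Section Extremes.

Variables (n : nat).
Hypothesis n_gt1 : 1 < n.
Implicit Types (vs : seq 'I_n) (ds : seq 'I_(2 * n)).

Fact lo_subproof : 0 < 2 * n. Proof. lia. Qed.
Fact hi_subproof : (2 * n).-1 < 2 * n. Proof. lia. Qed.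
Definition lo : 'I_(2 * n) := Ordinal lo_subproof.
Definition hi : 'I_(2 * n) := Ordinal hi_subproof.

Definition extremes (m h : nat) := nseq h hi ++ nseq (m - h) lo.

Lemma size_extremes m h : h <= m -> size (extremes m h) = m.
Proof. by move=> hm; rewrite size_cat !size_nseq subnKC. Qed.

Lemma count_extremes m h (P : pred 'I_(2 * n)) :
  count P (extremes m h) = P hi * h + P lo * (m - h).
Proof. by rewrite count_cat !count_nseq. Qed.

(** The ordinals 0 and 1 lie below all of [ds]. With [h] further inputs at [hi], exactly
    [(uphalf n).-1] inputs exceed input [i] when it is 1, and the rest are [lo]; so input [i] is the
    median, of value 1 or 2. *)
Lemma median_sensitive vs ds i :
  uniq vs -> i \notin vs -> size ds = size vs ->
  all (fun d : 'I_(2 * n) => 1 < d) ds -> size vs < uphalf n ->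
  exists x x' : {ffun 'I_n -> 'I_(2 * n)},
    [/\ map x vs = ds, map x' vs = ds, forall j, j != i -> x j = x' j &
        median_bit x <> median_bit x'].
Proof.
move=> Uvs ivs sds ds2 svs; have Uivs : uniq (i :: vs) by rewrite /= ivs.
pose h := (uphalf n).-1 - size vs.
have hle : h <= n - (size vs).+1 by rewrite /h; lia.
have one : 1 < 2 * n by lia.
have val_x (c : 'I_(2 * n)) : c < 2 ->
  exists x : {ffun 'I_n -> 'I_(2 * n)},
    [/\ map x (i :: vs) = c :: ds,
        map x (unused (i :: vs)) = extremes (n - (size vs).+1) h &
        median x = c.+1].
  move=> c2; have [|x [xvs xun]] :=
    fill lo (ds := c :: ds) Uivs _ (size_extremes hle).
    by rewrite /= sds.
  exists x; split=> //; apply: (median_count Uivs).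
  rewrite xvs xun !count_extremes /= ltnn leqnn.
  have cds (P : pred 'I_(2 * n)) :
    {in ds, forall d, P d} -> count P ds = size ds.
    by move=> Pd; apply/eqP; rewrite -all_count; apply/allP.
  rewrite !cds; try by move=> d /(allP ds2) d1; lia.
  rewrite sds /h; have -> : (c < (2 * n).-1) by lia.
  have -> : (c <= (2 * n).-1) by lia.
  lia.
have [x [[xi xvs] xun mx]] := val_x lo isT.
have [x' [[xi' xvs'] xun' mx']] := val_x (Ordinal one) isT.
exists x, x'; split=> //; last by rewrite /median_bit mx mx'.
move=> j ji; have [jvs|jvs] := boolP (j \in vs).
  by move: xvs; rewrite -xvs' => /eq_in_map; apply.
move: xun; rewrite -xun' => /eq_in_map; apply.
by rewrite mem_filter mem_enum inE negb_or ji jvs.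
Qed.

(** Setting [(uphalf n).-1 - c] free inputs to [hi] and the others to [lo] moves the answer with [c]
    larger ones to the median. Both sides share [c], hence the filling. *)
Lemma median_select vs vs' ds ds' (d d' : 'I_(2 * n)) c :
  uniq vs -> uniq vs' -> vs =i vs' ->
  size ds = size vs -> size ds' = size vs' ->
  c < uphalf n <= n - size vs ->
  [/\ 0 < d < (2 * n).-1, count (fun e : 'I__ => d < e) ds = c &
      count (fun e : 'I__ => d <= e) ds = c.+1] ->
  [/\ 0 < d' < (2 * n).-1, count (fun e : 'I__ => d' < e) ds' = c &
      count (fun e : 'I__ => d' <= e) ds' = c.+1] ->
  exists x x' : {ffun 'I_n -> 'I_(2 * n)},
    [/\ map x vs = ds, map x' vs' = ds', forall j, j \notin vs -> x j = x' j,
        median x = d.+1 & median x' = d'.+1].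
Proof.
move=> Uvs Uvs' evs sds sds' cr dP dP'.
have svs : size vs = size vs' by apply/perm_size/uniq_perm.
pose h := (uphalf n).-1 - c.
have hle : h <= n - size vs by rewrite /h; lia.
have val_x ws es (e : 'I_(2 * n)) : uniq ws -> size ws = size vs ->
    size es = size ws ->
    [/\ 0 < e < (2 * n).-1, count (fun e' : 'I__ => e < e') es = c &
      count (fun e' : 'I__ => e <= e') es = c.+1] ->
  exists x : {ffun 'I_n -> 'I_(2 * n)},
    [/\ map x ws = es, map x (unused ws) = extremes (n - size vs) h &
        median x = e.+1].
  move=> Uws sws ses [/andP[e0 eh] ce ce'].
  have [|x [xws xun]] := fill lo Uws ses (es := extremes (n - size vs) h).
    by rewrite size_extremes // sws.
  exists x; split=> //; apply: (median_count Uws).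
  rewrite xws xun ce ce' !count_extremes /= eh (ltnW eh) leqn0 (gtn_eqF e0).
  rewrite /h; lia.
have [x [xvs xun mx]] := val_x _ _ _ Uvs erefl sds dP.
have [x' [xvs' xun' mx']] := val_x _ _ _ Uvs' (esym svs) sds' dP'.
exists x, x'; split=> // j jvs.
have euv : unused vs = unused vs' by apply: eq_filter => i; rewrite evs.
move: xun; rewrite euv -xun' => /eq_in_map; apply.
by rewrite mem_filter mem_enum -evs jvs.
Qed.

(** Different [t] use disjoint pairs, increasing in [t]: the ranking is independent of [b], while
    [b t] sets the parity. Starting at 2 keeps 0 and 1 for [median_sensitive]. The default [lo] does
    not occur when [k < n.-1]. *)
Definition answers k (b : {ffun 'I_k -> bool}) : seq 'I_(2 * n) :=
  [seq insubd lo (2 * t.+1 + b t) | t : 'I_k <- enum 'I_k].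

Lemma val_answer k (b : {ffun 'I_k -> bool}) (t : 'I_k) : k < n.-1 ->
  insubd lo (2 * t.+1 + b t) = 2 * t.+1 + b t :> nat.
Proof.
move=> kn; rewrite val_insubd ifT //.
by have := ltn_ord t; case: (b t); lia.
Qed.

(** Exactly the later answers are larger, whatever the bits. *)
Lemma count_answers k (b : {ffun 'I_k -> bool}) (t : 'I_k) : k < n.-1 ->
  let d := insubd lo (2 * t.+1 + b t) in
  [/\ 0 < d < (2 * n).-1,
      count (fun e : 'I__ => d < e) (answers b) = k.-1 - t &
      count (fun e : 'I__ => d <= e) (answers b) = (k.-1 - t).+1].
Proof.
move=> kn d; have tk := ltn_ord t.
have dE : d = 2 * t.+1 + b t :> nat by apply: val_answer.
have count_ge m : count (fun j : 'I_k => m <= j) (enum 'I_k) = k - m.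
  rewrite -(count_map val (leq m)) val_enum_ord.
  have [km|/ltnW mk] := leqP k m.
    rewrite (eqP (_ : k - m == 0)) ?subn_eq0 //; apply/eqP.
    rewrite eqn0Ngt -has_count; apply/hasPn => j; rewrite mem_iota; lia.
  rewrite -{1}(subnKC mk) iotaD count_cat add0n.
  rewrite (_ : count _ (iota 0 m) = 0); last first.
    apply/eqP; rewrite eqn0Ngt -has_count; apply/hasPn => j.
    rewrite mem_iota; lia.
  rewrite -[RHS](size_iota m) add0n; apply/eqP; rewrite -all_count.
  by apply/allP => j; rewrite mem_iota => /andP[].
split; first by rewrite dE; case: (b t); lia.
- rewrite count_map (eq_count (a2 := fun j : 'I_k => t < j)) ?count_ge.
    lia.
  move=> j; rewrite /= dE val_answer //.
  have [->|/eqP jt] := eqVneq j t; first by rewrite !ltnn.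
  have {}jt : (j : nat) <> t by move/val_inj.
  by case: (b t); case: (b j); lia.
- rewrite count_map (eq_count (a2 := fun j : 'I_k => t <= j)) ?count_ge.
    lia.
  move=> j; rewrite /= dE val_answer //.
  have [->|/eqP jt] := eqVneq j t; first by rewrite !leqnn.
  have {}jt : (j : nat) <> t by move/val_inj.
  by case: (b t); case: (b j); lia.
Qed.

End Extremes.

(** * Distinct answer vectors reach distinct nodes *)

Lemma median_bit_lower_bound n (B : branching_program n 'I_(2 * n) bool) k :
  0 < k -> 4 * k <= n ->
  read_once B -> computes B (@median_bit n (2 * n)) -> 2 ^ k <= size_bp B.
Proof.
move=> k0 kn ro BF; have n_gt1 : 1 < n by lia.
have kn1 : k < n.-1 by lia.
pose P : pred 'I_(2 * n) := fun d => 1 < d.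
have sens q : uniq (unzip1 q) -> all P (unzip2 q) -> size q < k ->
    exists x x', [/\ agrees x q, agrees x' q &
      @median_bit n (2 * n) x <> median_bit x'].
  move=> Uq Pq sq.
  have [i iq] : exists i, i \notin unzip1 q.
    apply/existsP; rewrite -negb_forall; apply/negP => /forallP all_q.
    have: size (enum 'I_n) <= size (unzip1 q).
      by apply: uniq_leq_size; rewrite ?enum_uniq.
    rewrite size_enum_ord size_map; lia.
  have [||x [x' [xq xq' _ neq]]] := median_sensitive n_gt1 Uq iq _ Pq.
  - by rewrite !size_map.
  - rewrite size_map; lia.
  by exists x, x'; rewrite !agrees_map xq xq' eqxx.
have Pa (b : {ffun 'I_k -> bool}) : all P (answers n_gt1 b).
  by apply/allP => _ /mapP[t _ ->]; rewrite /P val_answer //; lia.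
have reach (b : {ffun 'I_k -> bool}) : exists v q,
    [/\ follows (source B) q v, uniq (unzip1 q) & unzip2 q = answers n_gt1 b].
  have [||q [v]] := reach_answers ro BF (ds := answers n_gt1 b) sens.
  - exact: Pa.
  - by rewrite size_map size_enum_ord.
  by exists v, q.
have [v vP] := fin_all_exists reach.
suff /leq_card : injective v by rewrite card_ffun card_bool card_ord.
move=> b b' vv; apply/ffunP => t.
have [q [fv Uq qE]] := vP b; have [q' [fv' Uq' qE']] := vP b'.
rewrite -vv in fv'.
have sq (p : seq ('I_n * _)) (c : {ffun 'I_k -> bool}) :
    unzip2 p = answers n_gt1 c -> size (unzip1 p) = k.
  move=> e; rewrite size_map -(size_map snd) -/(unzip2 p) e.
  by rewrite size_map size_enum_ord.
have sub q1 q2 (c c' : {ffun 'I_k -> bool}) :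
    follows (source B) q1 (v b) -> follows (source B) q2 (v b) ->
    uniq (unzip1 q1) -> unzip2 q1 = answers n_gt1 c ->
    unzip2 q2 = answers n_gt1 c' -> {subset unzip1 q2 <= unzip1 q1}.
  move=> f1 f2 U1 e1 e2 i i2; apply/negPn/negP => i1.
  have [|||x [x' [x1 x1' xx' neq]]] :=
    median_sensitive n_gt1 U1 i1 (ds := unzip2 q1).
  - by rewrite !size_map.
  - by rewrite e1; apply: Pa.
  - rewrite (sq _ _ e1); lia.
  (* Both inputs have history [q1]; [f2] serves to show that [i], being queried in [q2], is not read
     after the common node. *)
  apply: neq; apply: (meet_eq ro BF f1 f2 f1); rewrite ?agrees_map ?x1 ?x1' //.
  by move=> j _ j2; apply: xx'; apply: contraNneq j2 => ->.
have eqq : unzip1 q =i unzip1 q'.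
  by move=> i; apply/idP/idP; [apply: (sub q' q) | apply: (sub q q')];
    eassumption.
pose d (c : {ffun 'I_k -> bool}) : 'I_(2 * n) :=
  insubd (lo n_gt1) (2 * t.+1 + c t).
have tk := ltn_ord t.
(* On either side [k.-1 - t] answers exceed the [t]-th one, which becomes the median. *)
have [|||||x [x' [xq xq' xx' mx mx']]] :=
    @median_select n n_gt1 _ _ (unzip2 q) (unzip2 q') (d b) (d b') (k.-1 - t)
      Uq Uq' eqq.
- by rewrite !size_map.
- by rewrite !size_map.
- rewrite (sq _ _ qE); lia.
- by rewrite qE; apply: count_answers.
- by rewrite qE'; apply: count_answers.
have: median_bit x = median_bit x'.
  apply: (meet_eq ro BF fv fv' fv'); rewrite ?agrees_map ?xq ?xq' //.
  by move=> j jq _; apply: xx'.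
(* The medians are [2 * t.+1 + b t + 1] and the same with [b'], so equal parities give equal
   bits. *)
rewrite /median_bit mx mx' /d !val_answer //.
rewrite !mul2n !oddS !oddD !odd_double !oddb.
by case: (b t); case: (b' t).
Qed.

Local Open Scope ring_scope.

Theorem corollary10 (R : realType) :
  exists2 eps : R, 0 < eps &
  exists n0 : nat, forall (n : nat), (n0 <= n)%N ->
  forall B : branching_program n 'I_(2 * n) bool,
    read_once B -> computes B (@median_bit n (2 * n)) ->
    2 `^ (n%:R `^ eps) <= (size_bp B)%:R.
Proof.
(* With [k = n %/ 4], [n <= 4 * k + 3 <= k * k] as soon as [k >= 5], that is [n >= 20]; hence the
   square root of [n] is at most [k]. *)
exists 2^-1; first by rewrite invr_gt0.
exists 20 => n n20 B ro BF.
have k5 : (5 <= n %/ 4)%N by lia.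
have nk : (n <= n %/ 4 * (n %/ 4))%N by nia.
have sqrt_n : n%:R `^ 2^-1 <= (n %/ 4)%:R :> R.
  rewrite powR12_sqrt // -[leRHS]ger0_norm // -sqrtr_sqr ler_sqrt ?sqr_ge0 //.
  by rewrite -natrX ler_nat.
apply: le_trans (_ : 2 `^ (n %/ 4)%:R <= _).
  by rewrite ler_powR // ler1n.
rewrite powR_mulrn // -natrX ler_nat.
by apply: median_bit_lower_bound ro BF; lia.
Qed.
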